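(* Let $$f_{\mathrm{SSWC}}(\theta|\mu,\rho,\lambda)=\frac{1-\rho^2}{2\pi\{1+\rho^2-2\rho\cos(\theta-\mu)\}}\{1+\lambda\sin(\theta-\mu)\}$$ be the density on the circle of the sine-skewed wrapped Cauchy (SSWC) distribution, and let $\Gamma_{\mathrm{WC}}=\{(\mu,\rho,\lambda)^T\mid 0\le\mu<2\pi,\ 0<\rho<1,\ -1\le\lambda\le1\}$. Then the family $\{f_{\mathrm{SSWC}}(\theta|\mu,\rho,\lambda)\mid(\mu,\rho,\lambda)^T\in\Gamma_{\mathrm{WC}}\}$ is identifiable.
   Context: Here $\theta$ ranges over the circle (an interval of length $2\pi$, e.g. $[0,2\pi)$). Identifiability: a family $\{f(\cdot|\bm{\gamma})\mid\bm{\gamma}\in\Gamma\}$ of densities is identifiable if $\bm{\gamma}_1\neq\bm{\gamma}_2$ in $\Gamma$ implies that $f(\cdot|\bm{\gamma}_1)$ and $f(\cdot|\bm{\gamma}_2)$ define different distributions (different cumulative distribution functions; equivalently, the densities are not equal almost everywhere). *)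

(* Defs.v *)
From HB Require Import structures.
From mathcomp Require Import all_boot all_order all_algebra.
From mathcomp Require Import all_classical all_reals all_analysis.

Set Implicit Arguments.
Unset Strict Implicit.
Unset Printing Implicit Defensive.

Import Order.TTheory GRing.Theory Num.Theory.
Import numFieldNormedType.Exports.

Local Open Scope classical_set_scope.
Local Open Scope ring_scope.

(* The circle is parametrized by theta in [0, 2 pi), with origin 0 for
   cumulative distribution functions: F(x) = int_0^x f(t) dt. *)
Definition circle_cdf (R : realType) (f : R -> R) (x : R) : \bar R :=
  (\int[lebesgue_measure]_(t in `[0%R, x]) (f t)%:E)%E.

(* Meant for families of densities on the circle: distinct parameters in
   Gamma give cumulative distribution functions that are distinct as
   functions on [0, 2 pi). *)
Definition identifiable (R : realType) (P : Type) (Gamma : set P)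
    (f : P -> R -> R) : Prop :=
  forall gamma1 gamma2 : P, Gamma gamma1 -> Gamma gamma2 ->
    gamma1 <> gamma2 ->
    ~ {in `[0, 2 * pi[, circle_cdf (f gamma1) =1 circle_cdf (f gamma2)}.

Definition f_SSWC (R : realType) (theta mu rho lambda : R) : R :=
  (1 - rho ^+ 2)
    / (2 * pi * (1 + rho ^+ 2 - 2 * rho * cos (theta - mu)))
  * (1 + lambda * sin (theta - mu)).

Definition Gamma_WC (R : realType) : set (R * R * R) :=
  [set gamma | let: (mu, rho, lambda) := gamma in
    [/\ 0 <= mu < 2 * pi, 0 < rho < 1 & -1 <= lambda <= 1]].

(* Main.v *)
Require Import Defs.
From mathcomp Require Import all_boot all_order all_algebra.
From mathcomp Require Import all_classical all_reals all_analysis.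
From mathcomp Require Import ring lra.

(** Continuous densities are determined by their distribution functions, so
    two parameters with the same distribution give two densities that agree
    on ]0, 2 pi[.  Write a_i = 1 - rho_i ^ 2.  Clearing denominators in the
    equality of the densities gives

    a_1 (1 + rho_2 ^ 2 - 2 rho_2 cos (t - mu_2)) (1 + lambda_1 sin (t - mu_1))
    = a_2 (1 + rho_1 ^ 2 - 2 rho_1 cos (t - mu_1)) (1 + lambda_2 sin (t - mu_2)),

    an equality of trigonometric polynomials of degree 2 in t.  Such a
    polynomial vanishes only if its five coefficients do
    ([trig_poly2_shift_eq0]).  In the variable t - mu_1, and with
    (c, s) = (cos, sin) of mu_2 - mu_1, the coefficients give:
    - second harmonic: a_1 rho_2 lambda_1 = a_2 rho_1 lambda_2;
    - constant term, using this: rho_2 ^ 2 - rho_1 ^ 2 = a_1 rho_2 lambda_1 s;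
    - cosine term: 2 a_1 rho_2 c = 2 a_2 rho_1 + a_2 (1 + rho_1 ^ 2) lambda_2 s.
    Multiplying the last one by rho_1 and eliminating lambda_2 s with the other
    two leaves 2 rho_1 rho_2 c = rho_1 ^ 2 + rho_2 ^ 2.  As c <= 1, this is the
    equality case of the arithmetic-geometric inequality: rho_1 = rho_2 and
    c = 1.  Hence mu_1 = mu_2, since both lie in [0, 2 pi), and the sine term
    then gives lambda_1 = lambda_2 ([harmonics_determine_parameters]). *)

Set Implicit Arguments.
Unset Strict Implicit.
Unset Printing Implicit Defensive.

Import Order.TTheory GRing.Theory Num.Theory.
Import numFieldNormedType.Exports.

Local Open Scope classical_set_scope.
Local Open Scope ring_scope.

(** * Continuous densities are determined by their distribution functions *)

(** By the fundamental theorem of calculus, both densities are the derivative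
    of the same function at an interior point of [0, b]. *)
Lemma circle_cdf_inj (R : realType) (f g : R -> R) (b : R) :
    continuous f -> continuous g ->
    {in `[0, b[, circle_cdf f =1 circle_cdf g} ->
  {in `]0, b[, f =1 g}.
Proof.
move=> cf cg fg x; rewrite in_itv/= => /andP[x0 xb].
have intc (h : R -> R) : continuous h ->
    lebesgue_measure.-integrable `[0, b] (EFin \o h).
  move=> ch; apply: continuous_compact_integrable; first exact: segment_compact.
  exact: continuous_subspaceT.
have [_ <-] := continuous_FTC1_closed xb (intc _ cf) x0 (cf x).
have [_ <-] := continuous_FTC1_closed xb (intc _ cg) x0 (cg x).
rewrite !derive1E; apply: near_eq_derive.
near=> y; rewrite /Rintegral; congr fine; apply: fg.
rewrite in_itv/=; apply/andP; split; near: y.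
  by near do apply: ltW; exact: lt_nbhsr.
exact: lt_nbhsl.
Unshelve. all: by end_near. Qed.

(** * Trigonometric polynomials of degree 2 *)

Lemma unit_circle_angle (R : realType) (x y : R) :
    x ^+ 2 + y ^+ 2 = 1 -> x < 1 ->
  exists2 t, 0 < t < 2 * pi & cos t = x /\ sin t = y.
Proof.
move=> xy x1; have xN1 : -1 <= x by nra.
have pi0 := pi_gt0 R.
have xI : -1 <= x <= 1 by rewrite xN1 ltW.
have cx : cos (acos x) = x by rewrite acosK// in_itv.
have sx : sin (acos x) = `|y|.
  by rewrite sin_acos// -sqrtr_sqr; congr Num.sqrt; rewrite -xy; ring.
have a0 : 0 < acos x by rewrite acos_gt0// xN1.
have api : acos x <= pi by rewrite acos_lepi.
have [y0|y0] := leP 0 y.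
  exists (acos x); first by rewrite a0/=; lra.
  by rewrite cx sx ger0_norm.
exists (pi *+ 2 - acos x); first by rewrite -mulr_natl; apply/andP; split; lra.
rewrite cosB sinB cos2pi sin2pi cx sx ltr0_norm//; split; ring.
Qed.

(** The angle 0 is excluded by the open interval, so the coefficients are
    recovered from other points of the circle; rational ones suffice. *)
Lemma trig_poly2_eq0 (R : realType) (A B C D E : R) :
    (forall t, 0 < t < 2 * pi ->
      A + B * cos t + C * sin t + D * (cos t ^+ 2 - sin t ^+ 2)
        + E * (2 * (cos t * sin t)) = 0) ->
  [/\ A = 0, B = 0, C = 0, D = 0 & E = 0].
Proof.
move=> P0.
have P (x y : R) : x ^+ 2 + y ^+ 2 = 1 -> x < 1 ->
    A + B * x + C * y + D * (x ^+ 2 - y ^+ 2) + E * (2 * (x * y)) = 0.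
  by move=> xy x1; have [t /P0 Pt [<- <-]] := unit_circle_angle xy x1.
have h1 := P (-1) 0 ltac:(lra) ltac:(lra).
have h2 := P 0 1 ltac:(lra) ltac:(lra).
have h3 := P 0 (-1) ltac:(lra) ltac:(lra).
have h4 := P (3/5) (4/5) ltac:(lra) ltac:(lra).
have h5 := P (3/5) (-(4/5)) ltac:(lra) ltac:(lra).
have h6 := P (-(3/5)) (4/5) ltac:(lra) ltac:(lra).
split; lra.
Qed.

(** The change of variable t - m acts on the harmonics of order k by the
    rotation of angle k m, so the new coefficients vanish with the old ones. *)
Lemma trig_poly2_shift_eq0 (R : realType) (m A B C D E : R) :
    (forall t, 0 < t < 2 * pi ->
      A + B * cos (t - m) + C * sin (t - m)
        + D * (cos (t - m) ^+ 2 - sin (t - m) ^+ 2)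
        + E * (2 * (cos (t - m) * sin (t - m))) = 0) ->
  [/\ A = 0, B = 0, C = 0, D = 0 & E = 0].
Proof.
set c := cos m; set s := sin m.
have cs : c ^+ 2 + s ^+ 2 = 1 := cos2Dsin2 m.
set p := c ^+ 2 - s ^+ 2; set q := 2 * (c * s).
have pq : p ^+ 2 + q ^+ 2 = 1.
  rewrite -[RHS](expr1n _ 2) -cs /p /q; ring.
move=> P0.
have [] := @trig_poly2_eq0 R A (B * c - C * s) (B * s + C * c)
             (D * p - E * q) (D * q + E * p).
  move=> t /P0 <-; rewrite cosB sinB -/c -/s /p /q; ring.
move=> A0 B0 C0 D0 E0; split => //.
- transitivity ((B * c - C * s) * c + (B * s + C * c) * s); last first.
    by rewrite B0 C0; ring.
  by rewrite -[LHS]mulr1 -cs; ring.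
- transitivity ((B * s + C * c) * c - (B * c - C * s) * s); last first.
    by rewrite B0 C0; ring.
  by rewrite -[LHS]mulr1 -cs; ring.
- transitivity ((D * p - E * q) * p + (D * q + E * p) * q); last first.
    by rewrite D0 E0; ring.
  by rewrite -[LHS]mulr1 -pq; ring.
- transitivity ((D * q + E * p) * p - (D * p - E * q) * q); last first.
    by rewrite D0 E0; ring.
  by rewrite -[LHS]mulr1 -pq; ring.
Qed.

Lemma cos_eq1_itv (R : realType) (x : R) : `|x| < 2 * pi -> cos x = 1 -> x = 0.
Proof.
move=> xpi x1; apply/eqP; rewrite -normr_eq0; apply/eqP.
have {x1} : cos `|x| = cos 0 by rewrite cos0 -x1; case: ler0P; rewrite ?cosN.
have pi0 := pi_ge0 R.
have [xp|xp] := leP `|x| pi.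
  by apply: cos_inj; rewrite in_itv/= ?normr_ge0 ?lexx.
have -> : cos `|x| = cos (pi *+ 2 - `|x|).
  by rewrite cosB cos2pi sin2pi; ring.
have : 0 <= pi *+ 2 - `|x| <= pi by rewrite -mulr_natl; apply/andP; split; lra.
move=> h /cos_inj; rewrite !in_itv/= h lexx pi0 => /(_ isT isT).
rewrite -mulr_natl; lra.
Qed.

(** * Comparison of two sine-skewed wrapped Cauchy densities *)

Lemma wrapped_cauchy_denom_gt0 (R : realType) (rho x : R) :
  0 < rho < 1 -> 0 < 1 + rho ^+ 2 - 2 * rho * cos x.
Proof. by move=> /andP[r0 r1]; have := cos_le1 x; nra. Qed.

Lemma continuous_f_SSWC (R : realType) (mu rho lambda : R) :
  0 < rho < 1 -> continuous (fun t => f_SSWC t mu rho lambda).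
Proof.
move=> r01 x.
have ct : {for x, continuous (fun t : R => t - mu)}.
  by apply: continuousB; [exact: cvg_id|exact: cvg_cst].
have cc : {for x, continuous (fun t : R => cos (t - mu))}.
  by apply: (@continuous_comp _ _ _ (fun t => t - mu) cos);
    last exact: continuous_cos.
have cs : {for x, continuous (fun t : R => sin (t - mu))}.
  by apply: (@continuous_comp _ _ _ (fun t => t - mu) sin);
    last exact: continuous_sin.
apply: cvgM.
  apply: cvgM; first exact: cvg_cst.
  apply: cvgV.
    by rewrite !mulf_neq0 ?gt_eqF ?pi_gt0 ?wrapped_cauchy_denom_gt0.
  apply: cvgM; first exact: cvg_cst.
  apply: cvgB; first exact: cvg_cst.
  by apply: cvgM; [exact: cvg_cst|exact: cc].
apply: cvgD; first exact: cvg_cst.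
by apply: cvgM; [exact: cvg_cst|exact: cs].
Qed.

Lemma f_SSWC_eq_cross (R : realType) (t m1 m2 r1 r2 l1 l2 : R) :
    0 < r1 < 1 -> 0 < r2 < 1 -> f_SSWC t m1 r1 l1 = f_SSWC t m2 r2 l2 ->
  (1 - r1 ^+ 2) * (1 + r2 ^+ 2 - 2 * r2 * cos (t - m2))
      * (1 + l1 * sin (t - m1)) =
  (1 - r2 ^+ 2) * (1 + r1 ^+ 2 - 2 * r1 * cos (t - m1))
      * (1 + l2 * sin (t - m2)).
Proof.
move=> r1I r2I; rewrite /f_SSWC.
have := wrapped_cauchy_denom_gt0 (t - m1) r1I.
have := wrapped_cauchy_denom_gt0 (t - m2) r2I.
set d1 := 1 + r1 ^+ 2 - _; set d2 := 1 + r2 ^+ 2 - _ => d2_gt0 d1_gt0.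
have d1N : d1 != 0 by rewrite gt_eqF.
have d2N : d2 != 0 by rewrite gt_eqF.
have : @pi R != 0 by rewrite gt_eqF ?pi_gt0.
move: (@pi R) => p pN.
have -> : (1 - r1 ^+ 2) / (2 * p * d1) * (1 + l1 * sin (t - m1)) =
    (1 - r1 ^+ 2) * d2 * (1 + l1 * sin (t - m1)) / (2 * p * d1 * d2).
  by field; rewrite d1N d2N pN.
have -> : (1 - r2 ^+ 2) / (2 * p * d2) * (1 + l2 * sin (t - m2)) =
    (1 - r2 ^+ 2) * d1 * (1 + l2 * sin (t - m2)) / (2 * p * d1 * d2).
  by field; rewrite d1N d2N pN.
by apply: mulIf; rewrite invr_neq0// !mulf_neq0.
Qed.

(** The last four hypotheses say that the second harmonic, the constant term,
    the cosine term and the sine term of the difference of the two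
    cross-multiplied densities vanish, with (c, s) = (cos, sin) of the
    difference of the locations. *)
Lemma harmonics_determine_parameters (F : realFieldType) (r1 r2 l1 l2 c s : F) :
    0 < r1 < 1 -> 0 < r2 < 1 -> c ^+ 2 + s ^+ 2 = 1 ->
    (1 - r1 ^+ 2) * r2 * l1 = (1 - r2 ^+ 2) * r1 * l2 ->
    (1 - r1 ^+ 2) * (1 + r2 ^+ 2) - (1 - r2 ^+ 2) * (1 + r1 ^+ 2) =
      ((1 - r1 ^+ 2) * r2 * l1 + (1 - r2 ^+ 2) * r1 * l2) * s ->
    2 * (1 - r1 ^+ 2) * r2 * c =
      2 * (1 - r2 ^+ 2) * r1 + (1 - r2 ^+ 2) * (1 + r1 ^+ 2) * l2 * s ->
    (1 - r1 ^+ 2) * (1 + r2 ^+ 2) * l1 - 2 * (1 - r1 ^+ 2) * r2 * s =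
      (1 - r2 ^+ 2) * (1 + r1 ^+ 2) * l2 * c ->
  [/\ c = 1, r1 = r2 & l1 = l2].
Proof.
move=> /andP[r1_gt0 r1_lt1] /andP[r2_gt0 r2_lt1] cs h2 h0 hc hs.
have a1_gt0 : 0 < 1 - r1 ^+ 2 by nra.
have {h0} h0 : r2 ^+ 2 - r1 ^+ 2 = (1 - r2 ^+ 2) * r1 * l2 * s.
  move: h0; rewrite h2; lra.
(* This is where lambda drops out of the equations. *)
have key : 2 * r1 * r2 * c = r1 ^+ 2 + r2 ^+ 2.
  apply: (mulfI (lt0r_neq0 a1_gt0)).
  transitivity (r1 * (2 * (1 - r1 ^+ 2) * r2 * c)); first by ring.
  rewrite hc; transitivity (2 * (1 - r2 ^+ 2) * r1 ^+ 2
      + (1 + r1 ^+ 2) * ((1 - r2 ^+ 2) * r1 * l2 * s)); first by ring.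
  by rewrite -h0; ring.
have c1 : c <= 1 by nra.
have r12_gt0 : 0 < r1 * r2 by rewrite mulr_gt0.
have r12 : r1 = r2.
  apply/eqP; rewrite -subr_eq0 -sqrf_eq0 eq_le sqr_ge0 andbT.
  have -> : (r1 - r2) ^+ 2 = - (2 * (r1 * r2) * (1 - c)).
    by transitivity (r1 ^+ 2 + r2 ^+ 2 - 2 * r1 * r2); [|rewrite -key]; ring.
  by rewrite oppr_le0 !mulr_ge0 ?subr_ge0// ltW.
subst r2.
have {}c1 : c = 1.
  apply: (mulfI (lt0r_neq0 r12_gt0)); move: key; lra.
split=> //; apply: (mulfI (lt0r_neq0 (mulr_gt0 a1_gt0 r1_gt0))).
by rewrite h2.
Qed.

Theorem proposition3 (R : realType) :
  identifiable (@Gamma_WC R)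
    (fun (gamma : R * R * R) (theta : R) =>
       let: (mu, rho, lambda) := gamma in f_SSWC theta mu rho lambda).
Proof.
move=> [[m1 r1] l1] [[m2 r2] l2] [m1I r1I _] [m2I r2I _] neq cdf_eq.
apply: neq.
have f_eq := circle_cdf_inj (@continuous_f_SSWC R m1 r1 l1 r1I)
                            (@continuous_f_SSWC R m2 r2 l2 r2I) cdf_eq.
set c := cos (m2 - m1); set s := sin (m2 - m1).
have cs : c ^+ 2 + s ^+ 2 = 1 := cos2Dsin2 (m2 - m1).
(* The second harmonic is K times a unit vector. *)
pose K := (1 - r1 ^+ 2) * r2 * l1 - (1 - r2 ^+ 2) * r1 * l2.
have [] := @trig_poly2_shift_eq0 R m1
  ((1 - r1 ^+ 2) * (1 + r2 ^+ 2) - (1 - r2 ^+ 2) * (1 + r1 ^+ 2)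
     - ((1 - r1 ^+ 2) * r2 * l1 + (1 - r2 ^+ 2) * r1 * l2) * s)
  (2 * (1 - r2 ^+ 2) * r1 + (1 - r2 ^+ 2) * (1 + r1 ^+ 2) * l2 * s
     - 2 * (1 - r1 ^+ 2) * r2 * c)
  ((1 - r1 ^+ 2) * (1 + r2 ^+ 2) * l1 - 2 * (1 - r1 ^+ 2) * r2 * s
     - (1 - r2 ^+ 2) * (1 + r1 ^+ 2) * l2 * c)
  (K * s) (- (K * c)).
  move=> t tI; have := f_SSWC_eq_cross r1I r2I (f_eq t _).
  rewrite in_itv/= => /(_ tI).
  have -> : t - m2 = (t - m1) - (m2 - m1) by ring.
  move: (t - m1) => u; rewrite (cosB u) (sinB u) -/c -/s.
  have := cos2Dsin2 u; move: (cos u) (sin u) => x y xy /eqP.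
  rewrite -subr_eq0 => /eqP h.
  (* Splitting the products of two first harmonics into a constant and a
     second harmonic costs a multiple of x ^ 2 + y ^ 2 - 1. *)
  have hk : ((1 - r1 ^+ 2) * r2 * l1 + (1 - r2 ^+ 2) * r1 * l2) * s
      * (x ^+ 2 + y ^+ 2 - 1) = 0 by rewrite xy subrr mulr0.
  by apply: etrans (etrans (congr2 +%R h hk) (addr0 0)); rewrite /K; ring.
move=> h0 hc hs hS hC.
have K0 : K = 0.
  transitivity ((K * s) * s - (- (K * c)) * c); last by rewrite hS hC; ring.
  by rewrite -[LHS]mulr1 -cs; ring.
have [c1 -> ->] := harmonics_determine_parameters r1I r2I cs
  (subr0_eq K0) (subr0_eq h0) (esym (subr0_eq hc)) (subr0_eq hs).
suff /subr0_eq -> : m2 - m1 = 0 by [].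
apply: cos_eq1_itv c1; rewrite ltr_norml.
by move/andP: m1I => [? ?]; move/andP: m2I => [? ?]; apply/andP; split; lra.
Qed.
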